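(* For every completely positive trace-preserving (CPTP) linear map $\Phi:\Omega_2\to\Omega_2$ and all $\rho^A,\rho^B\in\Omega_2$, $$T^Q\big(\Phi(\rho^A),\Phi(\rho^B)\big)\le T^Q(\rho^A,\rho^B).$$ Equivalently, $W(\Phi(\rho^A),\Phi(\rho^B))\le W(\rho^A,\rho^B)$ with $W=\sqrt{T^Q}$.
   Context: $\Omega_N=\{\rho\in\mathbb{C}^{N\times N}:\rho=\rho^*,\ \rho\ge0,\ \operatorname{Tr}\rho=1\}$ is the set of density matrices of order $N$. Let $S$ be the swap operator on $\mathbb{C}^N\otimes\mathbb{C}^N$, $S(|x\rangle|y\rangle)=|y\rangle|x\rangle$, and let $C^Q=\tfrac12(\mathbb{1}-S)$, the projector onto the antisymmetric subspace. For $\rho^A,\rho^B\in\Omega_N$, let $\Gamma^Q(\rho^A,\rho^B)$ be the set of density matrices $\rho^{AB}$ on $\mathbb{C}^N\otimes\mathbb{C}^N$ with partial traces $\operatorname{Tr}_B\rho^{AB}=\rho^A$ and $\operatorname{Tr}_A\rho^{AB}=\rho^B$. The optimal quantum transport cost is $$T^Q(\rho^A,\rho^B)=\min_{\rho^{AB}\in\Gamma^Q(\rho^A,\rho^B)}\operatorname{Tr}(C^Q\rho^{AB}).$$ *)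

(* Defs.v *)
From HB Require Import structures.
From mathcomp Require Import all_boot all_order all_algebra.
From mathcomp Require Import complex mxtens.
From mathcomp Require Import boolp classical_sets reals.

Set Implicit Arguments.
Unset Strict Implicit.
Unset Printing Implicit Defensive.

Import Order.TTheory GRing.Theory Num.Theory.
Local Open Scope ring_scope.

Section QOT.
Variable R : realType.
Local Notation C := R[i].

Definition hadj {m n : nat} (A : 'M[C]_(m, n)) : 'M[C]_(n, m) :=
  (map_mx (@conjc R) A)^T.

Definition hermitian {n : nat} (A : 'M[C]_n) : Prop := A = hadj A.

(* A >= 0 : Hermitian with nonnegative quadratic form
   (order on C: 0 <= z iff z is real and nonnegative) *)
Definition psd {n : nat} (A : 'M[C]_n) : Prop :=
  hermitian A /\ forall v : 'cV[C]_n, 0 <= (hadj v *m A *m v) 0 0.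

Definition density {n : nat} (A : 'M[C]_n) : Prop := psd A /\ \tr A = 1.

(* Index convention: C^m (x) C^n has basis |i>|j> indexed by mxtens_index (i, j). *)

Definition ptraceB {m n : nat} (A : 'M[C]_(m * n)) : 'M[C]_m :=
  \matrix_(i, k) \sum_(j < n) A (mxtens_index (i, j)) (mxtens_index (k, j)).

Definition ptraceA {m n : nat} (A : 'M[C]_(m * n)) : 'M[C]_n :=
  \matrix_(j, l) \sum_(i < m) A (mxtens_index (i, j)) (mxtens_index (i, l)).

Definition swapmx (N : nat) : 'M[C]_(N * N) :=
  \matrix_(a, b) ((((mxtens_unindex a).1 == (mxtens_unindex b).2) &&
                   ((mxtens_unindex a).2 == (mxtens_unindex b).1))%:R : C).

(* C^Q = (1 - S)/2, projector onto the antisymmetric subspace *)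
Definition costQ (N : nat) : 'M[C]_(N * N) := 2^-1 *: (1%:M - swapmx N).

Definition couplings {N : nat} (rA rB : 'M[C]_N) : set 'M[C]_(N * N) :=
  [set rAB | density rAB /\ ptraceB rAB = rA /\ ptraceA rAB = rB].

(* T^Q(rhoA, rhoB) = min over couplings of Tr(C^Q rhoAB); the trace is real for
   Hermitian rhoAB, so we take its real part.  The minimum is attained
   (compact feasible set), so it coincides with the infimum used here. *)
Definition TQ {N : nat} (rA rB : 'M[C]_N) : R :=
  inf [set complex.Re (\tr (costQ N *m rAB)) | rAB in couplings rA rB].

(* (id_k (x) Phi) applied to a matrix on C^k (x) C^n *)
Definition ampliate {n : nat} (k : nat) (Phi : 'M[C]_n -> 'M[C]_n)
    (M : 'M[C]_(k * n)) : 'M[C]_(k * n) :=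
  \matrix_(a, b)
    (Phi (\matrix_(x, y) M (mxtens_index ((mxtens_unindex a).1, x))
                           (mxtens_index ((mxtens_unindex b).1, y))))
      (mxtens_unindex a).2 (mxtens_unindex b).2.

Arguments ampliate {n} k Phi M.

Definition completely_positive {n : nat} (Phi : 'M[C]_n -> 'M[C]_n) : Prop :=
  forall (k : nat) (M : 'M[C]_(k * n)), psd M -> psd (ampliate k Phi M).

Definition trace_preserving {n : nat} (Phi : 'M[C]_n -> 'M[C]_n) : Prop :=
  forall A : 'M[C]_n, \tr (Phi A) = \tr A.

End QOT.

(* Main.v *)
(* For qubits, T^Q(A, B) is the maximum over unit vectors u of
   (sqrt <u,Au> - sqrt <u,Bu>)^2 / 2.  Every coupling costs at least this much: the
   singlet is u (x) w - w (x) u for any orthonormal frame (u, w) of determinant 1, and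
   Cauchy-Schwarz for the coupling bounds its expectation from below.  A coupling
   attaining the bound is built at the u maximising sqrt <u,Au> - sqrt <u,Bu>, where A
   is the more mixed of the two states (det A >= det B): stationarity makes the
   off-diagonal entries of A and B in the frame equal to sqrt a t and sqrt b t, and a
   suitable coupling of rank at most two is then explicit.
   Monotonicity follows because r |-> <u, Phi(r) u> is given by an effect 0 <= E <= 1, so
   after diagonalising E it is x + d <w, r w> with x >= 0, 0 <= d <= 1 and w a unit vector,
   and |sqrt (x + d p) - sqrt (x + d q)| <= |sqrt p - sqrt q|. *)
Require Import Defs.
From HB Require Import structures.
From mathcomp Require Import all_boot all_order all_algebra.
From mathcomp Require Import complex mxtens.
From mathcomp Require Import boolp classical_sets reals.
From mathcomp Require Import topology normedtype derive realfun.
From mathcomp Require Import ring lra.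
Import Order.TTheory GRing.Theory Num.Theory.
Import numFieldNormedType.Exports.
Local Open Scope ring_scope.

Section QubitTransport.
Set Implicit Arguments.
Unset Strict Implicit.
Unset Printing Implicit Defensive.
Variable R : realType.
Local Notation C := R[i].

(** * Adjoints, quadratic forms and positivity *)

Definition qform {n} (X : 'M[C]_n) (v : 'cV[C]_n) : C := (hadj v *m X *m v) 0 0.

Lemma hadjE m n (A : 'M[C]_(m, n)) i j : hadj A i j = (A j i)^*%C.
Proof. by rewrite !mxE. Qed.

Lemma hadjK m n (A : 'M[C]_(m, n)) : hadj (hadj A) = A.
Proof. by apply/matrixP => i j; rewrite !hadjE conjcK. Qed.

Lemma hadjM m n p (A : 'M[C]_(m, n)) (B : 'M[C]_(n, p)) :
  hadj (A *m B) = hadj B *m hadj A.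
Proof. by rewrite /hadj map_mxM trmx_mul. Qed.

Lemma hadjD m n (A B : 'M[C]_(m, n)) : hadj (A + B) = hadj A + hadj B.
Proof. by rewrite /hadj map_mxD linearD. Qed.

Lemma hadjZ m n (a : C) (A : 'M[C]_(m, n)) : hadj (a *: A) = a^*%C *: hadj A.
Proof. by rewrite /hadj map_mxZ linearZ. Qed.

Lemma conj_ge0_id {z : C} : 0 <= z -> z^*%C = z.
Proof. by case: z => x y; rewrite lecE /= => /andP[/eqP -> _]; simpc. Qed.

Lemma Re_ge0 {z : C} : 0 <= z -> 0 <= complex.Re z.
Proof. by case: z => x y; rewrite lecE /= => /andP[_]. Qed.

Lemma ReK {z : C} : 0 <= z -> z = (complex.Re z)%:C%C.
Proof. by case: z => x y; rewrite lecE /= => /andP[/eqP -> _]. Qed.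

Lemma qformD n (X Y : 'M[C]_n) v : qform (X + Y) v = qform X v + qform Y v.
Proof. by rewrite /qform mulmxDr mulmxDl mxE. Qed.

Lemma qformZ n (a : C) (X : 'M[C]_n) v : qform (a *: X) v = a * qform X v.
Proof. by rewrite /qform -scalemxAr -scalemxAl mxE. Qed.

Lemma qform_scale n (X : 'M[C]_n) (a : C) v : qform X (a *: v) = a^*%C * a * qform X v.
Proof. by rewrite /qform hadjZ -!scalemxAl -scalemxAr !mxE mulrA. Qed.

Lemma qform_congr m n (X : 'M[C]_m) (V : 'M[C]_(m, n)) v :
  qform (hadj V *m X *m V) v = qform X (V *m v).
Proof. by rewrite /qform hadjM !mulmxA. Qed.

Lemma psd_congr m n (X : 'M[C]_m) (V : 'M[C]_(m, n)) :
  psd X -> psd (hadj V *m X *m V).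
Proof.
move=> [hX pX]; split; last by move=> v; have := pX (V *m v); rewrite hadjM !mulmxA.
by rewrite /Defs.hermitian !hadjM hadjK -hX mulmxA.
Qed.

Lemma psdD n (X Y : 'M[C]_n) : psd X -> psd Y -> psd (X + Y).
Proof.
move=> [hX pX] [hY pY]; split; first by rewrite /Defs.hermitian hadjD -hX -hY.
by move=> v; rewrite -/(qform _ _) qformD; apply: addr_ge0; [exact: pX|exact: pY].
Qed.

Lemma psd1 n : psd (1%:M : 'M[C]_n).
Proof.
split; first by apply/matrixP => i j; rewrite hadjE !mxE eq_sym conjc_nat.
move=> v; rewrite mulmx1 mxE sumr_ge0 // => i _.
by rewrite hadjE mulrC mulcJ_ge0.
Qed.

Lemma psd_gram m n (V : 'M[C]_(m, n)) : psd (V *m hadj V).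
Proof. by have := psd_congr (hadj V) (psd1 n); rewrite mulmx1 hadjK. Qed.

Lemma qform_delta n (X : 'M[C]_n) i : qform X (delta_mx i 0) = X i i.
Proof.
rewrite /qform -colE 2!mxE (bigD1 i) //= big1 ?addr0 => [|j /negPf ji].
  by rewrite !mxE !eqxx conjc_nat mul1r.
by rewrite !mxE ji conjc_nat mul0r.
Qed.

Lemma psd_diag_ge0 n (X : 'M[C]_n) i : psd X -> 0 <= X i i.
Proof. by move=> [_ /(_ (delta_mx i 0))]; rewrite -/(qform _ _) qform_delta. Qed.

Lemma congr_entry m n (X : 'M[C]_m) (U V : 'M[C]_(m, n)) i j :
  (hadj U *m X *m V) i j = (hadj (col i U) *m X *m col j V) 0 0.
Proof.
rewrite !mxE; apply: eq_bigr => k _; rewrite !mxE; congr (_ * _).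
by apply: eq_bigr => l _; rewrite !mxE.
Qed.

(** * Two by two matrices *)

Lemma lift01 : lift ord0 ord0 = 1 :> 'I_2.
Proof. exact: val_inj. Qed.

Lemma sum2 (V : nmodType) (F : 'I_2 -> V) : \sum_i F i = F 0 + F 1.
Proof. by rewrite !big_ord_recl big_ord0 addr0 lift01. Qed.

Lemma ord2P (P : 'I_2 -> Prop) : P 0 -> P 1 -> forall i, P i.
Proof.
by move=> P0 P1 [[|[|//]] ?]; [move: P0|move: P1]; congr P; apply: val_inj.
Qed.

Lemma matrix2P (A B : 'M[C]_2) :
  A 0 0 = B 0 0 -> A 0 1 = B 0 1 -> A 1 0 = B 1 0 -> A 1 1 = B 1 1 -> A = B.
Proof. by move=> *; apply/matrixP; elim/ord2P => //; elim/ord2P. Qed.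

Lemma qform2E (M : 'M[C]_2) v : qform M v =
  (v 0 0)^*%C * M 0 0 * v 0 0 + (v 0 0)^*%C * M 0 1 * v 1 0 +
  (v 1 0)^*%C * M 1 0 * v 0 0 + (v 1 0)^*%C * M 1 1 * v 1 0.
Proof. by rewrite /qform !mxE !sum2 !mxE !sum2 !hadjE; ring. Qed.

(** At the vector (-M01, M00) the form equals M00 times the determinant, which settles the case of
    nonzero M00. *)
Lemma psd2_minor (M : 'M[C]_2) : psd M -> M 0 1 * (M 0 1)^*%C <= M 0 0 * M 1 1.
Proof.
move=> pM; have M0 := psd_diag_ge0 0 pM; have M1 := psd_diag_ge0 1 pM.
have [hM qM] := pM; have M10 : M 1 0 = (M 0 1)^*%C by rewrite {1}hM hadjE.
have [M00|M00] := eqVneq (M 0 0) 0; last first.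
  have := qM (\col_i (if i == 0 then - M 0 1 else M 0 0)).
  rewrite -/(qform _ _) qform2E !mxE /= M10 rmorphN /= (conj_ge0_id M0).
  rewrite (_ : _ + _ = M 0 0 * (M 0 0 * M 1 1 - M 0 1 * (M 0 1)^*%C)); last by ring.
  by rewrite pmulr_rge0 ?subr_ge0 // lt_def M00.
rewrite M00 mul0r; set k := M 0 1 * _.
have k0 : 0 <= k by apply: mulcJ_ge0.
(* With M00 = 0 this vector gives -(M11 + 2) k^2, which is nonnegative only if k = 0; the summand 1
   in its first entry keeps the coefficient negative even when M11 = 0. *)
have := qM (\col_i (if i == 0 then - ((M 1 1 + 1) * M 0 1) else k)).
rewrite -/(qform _ _) qform2E !mxE /= M10 M00 rmorphN rmorphM rmorphD rmorph1 /=.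
rewrite (conj_ge0_id M1) (conj_ge0_id k0).
rewrite (_ : _ + _ = - (M 1 1 + 2) * k ^+ 2); last by rewrite /k; ring.
rewrite mulNr oppr_ge0 pmulr_rle0 ?ltr_wpDl //.
move=> h; have : k ^+ 2 == 0 by rewrite eq_le h exprn_ge0.
by rewrite expf_eq0 /= => /eqP ->.
Qed.

(** * Bipartite vectors and partial traces *)

(** Vectors of the tensor product are handled through their coefficient matrices: u (x) v is
    [ket (u *m v^T)], and the marginals of a pure state become the Gram matrices of [G] and
    [G^T]. *)
Definition ket m n (G : 'M[C]_(m, n)) : 'cV[C]_(m * n) :=
  \col_a G (mxtens_unindex a).1 (mxtens_unindex a).2.

Lemma ketE m n (G : 'M[C]_(m, n)) i j k : ket G (mxtens_index (i, j)) k = G i j.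
Proof. by rewrite mxE mxtens_indexK. Qed.

Lemma sum_mxtens (V : nmodType) m n (F : 'I_(m * n) -> V) :
  \sum_a F a = \sum_(i < m) \sum_(j < n) F (mxtens_index (i, j)).
Proof.
rewrite pair_big /= (reindex (@mxtens_index m n)) /=; first by apply: eq_bigr => -[].
by exists (@mxtens_unindex m n) => a _; rewrite (mxtens_indexK, mxtens_unindexK).
Qed.

Lemma gram_ketE m n (G : 'M[C]_(m, n)) i j k l :
  (ket G *m hadj (ket G)) (mxtens_index (i, j)) (mxtens_index (k, l)) =
  G i j * (G k l)^*%C.
Proof. by rewrite mxE big_ord1 hadjE !ketE. Qed.

Lemma ptraceB_gram m n (G : 'M[C]_(m, n)) :
  ptraceB (ket G *m hadj (ket G)) = G *m hadj G.
Proof.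
apply/matrixP => i k; rewrite !mxE; apply: eq_bigr => j _.
by rewrite gram_ketE hadjE.
Qed.

Lemma ptraceA_gram m n (G : 'M[C]_(m, n)) :
  ptraceA (ket G *m hadj (ket G)) = G^T *m hadj G^T.
Proof.
apply/matrixP => i k; rewrite !mxE; apply: eq_bigr => j _.
by rewrite gram_ketE hadjE !mxE.
Qed.

Lemma ptraceBD m n (X Y : 'M[C]_(m * n)) :
  ptraceB (X + Y) = ptraceB X + ptraceB Y.
Proof. by apply/matrixP => i k; rewrite !mxE -big_split; apply: eq_bigr => j _; rewrite mxE. Qed.

Lemma ptraceAD m n (X Y : 'M[C]_(m * n)) :
  ptraceA (X + Y) = ptraceA X + ptraceA Y.
Proof. by apply/matrixP => i k; rewrite !mxE -big_split; apply: eq_bigr => j _; rewrite mxE. Qed.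

Lemma mxtrace_ptraceB m n (X : 'M[C]_(m * n)) : \tr (ptraceB X) = \tr X.
Proof. by rewrite /mxtrace sum_mxtens; apply: eq_bigr => i _; rewrite mxE. Qed.

(** * The singlet and the transport cost *)

Definition eps : 'M[C]_2 := delta_mx 0 1 - delta_mx 1 0.

Lemma conj_eps i j : (eps i j)^*%C = eps i j.
Proof. by rewrite !mxE rmorphB !rmorph_nat. Qed.

(** For qubits the antisymmetric subspace is the line spanned by |01> - |10>, which is [ket eps], of
    squared norm 2. *)
Lemma costQ2E : costQ R 2 = 2^-1 *: (ket eps *m hadj (ket eps)).
Proof.
congr (_ *: _); apply/matrixP => a b.
case: (mxtens_indexP a) => i j; case: (mxtens_indexP b) => k l.
rewrite gram_ketE conj_eps !mxE !mxtens_indexK (can_eq (@mxtens_indexK _ _)) xpair_eqE /=.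
by elim/ord2P: i; elim/ord2P: j; elim/ord2P: k; elim/ord2P: l;
  rewrite /=; ring.
Qed.

Lemma cost_qform (X : 'M[C]_(2 * 2)) :
  \tr (costQ R 2 *m X) = 2^-1 * qform X (ket eps).
Proof.
by rewrite costQ2E -scalemxAl mxtraceZ -mulmxA mxtrace_mulC trace_mx11.
Qed.

Lemma qform_ket (X : 'M[C]_(2 * 2)) G : qform X (ket G) =
  \sum_i \sum_j \sum_k \sum_l
    (G i j)^*%C * X (mxtens_index (i, j)) (mxtens_index (k, l)) * G k l.
Proof.
rewrite /qform -mulmxA mxE sum_mxtens; apply: eq_bigr => i _; apply: eq_bigr => j _.
rewrite hadjE ketE mxE sum_mxtens mulr_sumr; apply: eq_bigr => k _.
by rewrite mulr_sumr; apply: eq_bigr => l _; rewrite ketE mulrA.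
Qed.

(** Pairing with the singlet reads off the antisymmetric part of [G]; a symmetric coefficient matrix
    costs nothing. *)
Lemma cost_gram (G : 'M[C]_2) : \tr (costQ R 2 *m (ket G *m hadj (ket G))) =
  2^-1 * ((G 0 1 - G 1 0) * (G 0 1 - G 1 0)^*%C).
Proof.
rewrite cost_qform qform_ket !sum2 !conj_eps !gram_ketE !mxE /=.
by rewrite [in RHS]rmorphB /=; ring.
Qed.

(** * Orthonormal frames and partial traces computed in them *)

(** The conjugates and the sign in the second column make the determinant |u|^2, so a unit vector
    gives an element of SU(2), under which the singlet is invariant. *)
Definition frame (u : 'cV[C]_2) : 'M[C]_2 := \matrix_(i, j)
  if j == 0 then u i 0 else if i == 0 then - (u 1 0)^*%C else (u 0 0)^*%C.

Definition unitv (u : 'cV[C]_2) : Prop := u 0 0 * (u 0 0)^*%C + u 1 0 * (u 1 0)^*%C = 1.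

Lemma col0_frame u : col 0 (frame u) = u.
Proof. by apply/matrixP => i j; rewrite !mxE /= (ord1 j). Qed.

Lemma frame_unitary u : unitv u -> hadj (frame u) *m frame u = 1%:M.
Proof.
rewrite /unitv => hu; apply: matrix2P; rewrite !mxE sum2 !mxE /= ?rmorphN /= ?conjcK; last 1 first.
- by rewrite -[RHS]hu; ring.
- by rewrite -[RHS]hu; ring.
- by ring.
- by ring.
Qed.

Lemma qformE n (X : 'M[C]_n) v :
  qform X v = \sum_i \sum_k (v i 0)^*%C * X i k * v k 0.
Proof.
rewrite /qform -mulmxA mxE; apply: eq_bigr => i _.
by rewrite hadjE mxE mulr_sumr; apply: eq_bigr => k _; rewrite mulrA.
Qed.

Lemma mxtrace_unitary n (X U : 'M[C]_n) : hadj U *m U = 1%:M ->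
  \tr X = \sum_z qform X (col z U).
Proof.
move=> hU; transitivity (\tr (hadj U *m X *m U)).
  by rewrite mxtrace_mulC mulmxA (mulmx1C hU) mul1mx.
by apply: eq_bigr => z _; rewrite congr_entry.
Qed.

(** Each entry of the partial trace is the trace of a block [Y i k], and a trace may be taken in the
    orthonormal basis of the columns of [U]. *)
Lemma qform_ptraceB m n (X : 'M[C]_(m * n)) (U : 'M[C]_n) u : hadj U *m U = 1%:M ->
  qform (ptraceB X) u = \sum_z qform X (ket (u *m (col z U)^T)).
Proof.
move=> hU; rewrite qformE.
pose Y i k : 'M[C]_n := \matrix_(j, l) X (mxtens_index (i, j)) (mxtens_index (k, l)).
have -> : \sum_i \sum_k (u i 0)^*%C * ptraceB X i k * u k 0 =
    \sum_i \sum_k \sum_z (u i 0)^*%C * qform (Y i k) (col z U) * u k 0.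
  apply: eq_bigr => i _; apply: eq_bigr => k _; rewrite -mulr_suml -mulr_sumr.
  rewrite -mxtrace_unitary //; congr (_ * _ * _).
  by rewrite mxE; apply: eq_bigr => j _; rewrite mxE.
under eq_bigr do rewrite exchange_big /=.
rewrite exchange_big; apply: eq_bigr => z _.
rewrite qformE sum_mxtens; apply: eq_bigr => i _.
under [RHS]eq_bigr do rewrite sum_mxtens.
rewrite exchange_big; apply: eq_bigr => k _ /=.
rewrite qformE mulr_sumr mulr_suml; apply: eq_bigr => j _.
rewrite mulr_sumr mulr_suml; apply: eq_bigr => l _.
by rewrite !ketE !mxE !big_ord1 !mxE rmorphM /=; ring.
Qed.

Lemma qform_ptraceA m n (X : 'M[C]_(m * n)) (U : 'M[C]_m) v : hadj U *m U = 1%:M ->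
  qform (ptraceA X) v = \sum_z qform X (ket (col z U *m v^T)).
Proof.
move=> hU; rewrite qformE.
pose Y j l : 'M[C]_m := \matrix_(i, k) X (mxtens_index (i, j)) (mxtens_index (k, l)).
have -> : \sum_j \sum_l (v j 0)^*%C * ptraceA X j l * v l 0 =
    \sum_j \sum_l \sum_z (v j 0)^*%C * qform (Y j l) (col z U) * v l 0.
  apply: eq_bigr => j _; apply: eq_bigr => l _; rewrite -mulr_suml -mulr_sumr.
  rewrite -mxtrace_unitary //; congr (_ * _ * _).
  by rewrite mxE; apply: eq_bigr => i _; rewrite mxE.
under eq_bigr do rewrite exchange_big /=.
rewrite exchange_big; apply: eq_bigr => z _.
rewrite qformE sum_mxtens [RHS]exchange_big; apply: eq_bigr => j _.
under [RHS]eq_bigr do rewrite sum_mxtens exchange_big.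
rewrite [RHS]exchange_big; apply: eq_bigr => l _ /=.
rewrite qformE mulr_sumr mulr_suml; apply: eq_bigr => i _.
rewrite mulr_sumr mulr_suml; apply: eq_bigr => k _.
by rewrite !ketE !mxE !big_ord1 !mxE rmorphM /=; ring.
Qed.

(** * The lower bound on the cost of a coupling *)

(** Expanding the squares leaves [x + s * t <= S * T], which is Cauchy-Schwarz for (sqrt x, s) and
    (sqrt x, t). It serves both the bound on couplings and the comparison of effects. *)
Lemma sqrtB_shift (x p r : R) : 0 <= x -> 0 <= p -> 0 <= r ->
  (Num.sqrt (x + p) - Num.sqrt (x + r)) ^+ 2 <= (Num.sqrt p - Num.sqrt r) ^+ 2.
Proof.
move=> x0 p0 r0.
have := sqr_sqrtr p0; have := sqr_sqrtr r0.
have := sqr_sqrtr (addr_ge0 x0 p0); have := sqr_sqrtr (addr_ge0 x0 r0).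
have := sqrtr_ge0 p; have := sqrtr_ge0 r.
have := sqrtr_ge0 (x + p); have := sqrtr_ge0 (x + r).
set s := Num.sqrt p; set t := Num.sqrt r.
set S := Num.sqrt (x + p); set T := Num.sqrt (x + r).
move=> T0 S0 t0 s0 T2 S2 t2 s2.
have : x + s * t <= S * T.
  rewrite -ler_sqr ?nnegrE ?addr_ge0 ?mulr_ge0 //.
  rewrite exprMn S2 T2 -s2 -t2; have := mulr_ge0 x0 (sqr_ge0 (s - t)); nra.
nra.
Qed.

Lemma psd_conj n (X : 'M[C]_n) i j : psd X -> (X i j)^*%C = X j i.
Proof. by move=> [hX _]; rewrite [in RHS]hX hadjE. Qed.

Lemma psd_qform_ge0 n (X : 'M[C]_n) v : psd X -> 0 <= qform X v.
Proof. by move=> [_ pX]; exact: pX. Qed.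

(** This is the reverse triangle inequality for the seminorm defined by [X]. The Gram matrix [G] of
    [v] and [w] is positive, and its minor bounds the real part of G01 by sqrt (G00 G11). *)
Lemma psd_qformB_ge n (X : 'M[C]_n) v w : psd X ->
  (Num.sqrt (complex.Re (qform X v)) - Num.sqrt (complex.Re (qform X w))) ^+ 2
  <= complex.Re (qform X (v - w)).
Proof.
move=> pX; pose V : 'M[C]_(n, 2) := \matrix_(i, j) if j == 0 then v i 0 else w i 0.
have V0 : col 0 V = v by apply/matrixP => i j; rewrite !mxE (ord1 j).
have V1 : col 1 V = w by apply/matrixP => i j; rewrite !mxE (ord1 j).
pose c : 'cV[C]_2 := \col_i if i == 0 then 1 else -1.
have -> : v - w = V *m c.
  by apply/matrixP => i j; rewrite !mxE sum2 !mxE /= (ord1 j) mulr1 mulrN1.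
have pG := psd_congr V pX; rewrite -qform_congr.
have -> : qform X v = (hadj V *m X *m V) 0 0 by rewrite congr_entry V0.
have -> : qform X w = (hadj V *m X *m V) 1 1 by rewrite congr_entry V1.
move: (hadj V *m X *m V) pG => {V V0 V1 pX} G pG.
rewrite qform2E !mxE -(psd_conj 0 1 pG).
move: (psd2_minor pG) (psd_diag_ge0 0 pG) (psd_diag_ge0 1 pG).
case: (G 0 0) (G 1 1) (G 0 1) => [p p'] [r r'] [x y]; rewrite !lecE /=.
rewrite !(mul0r, mulr0, subr0, addr0, mulNr, mulrN, opprK, mulr1, mul1r, oppr0).
move=> /andP[_ hxy] /andP[/eqP p'0 p0] /andP[/eqP r'0 r0].
rewrite p'0 r'0 mulr0 subr0 in hxy *.
have : x <= Num.sqrt p * Num.sqrt r.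
  rewrite -sqrtrM // (le_trans (ler_norm x)) // -sqrtr_sqr ler_wsqrtr //.
  by rewrite (le_trans _ hxy) // expr2 lerDl -expr2 sqr_ge0.
have := sqr_sqrtr p0; have := sqr_sqrtr r0; nra.
Qed.

Definition expval (A : 'M[C]_2) u : R := complex.Re (qform A u).

(** In the frame (u, w), <u,Au> is the weight of [X] on u (x) u plus that on u (x) w, and <u,Bu> the
    weight on u (x) u plus that on w (x) u. The shared term is dropped by [sqrtB_shift], and the
    other two are compared through the singlet. *)
Lemma cost_ge (A B : 'M[C]_2) X u : unitv u -> couplings A B X ->
  (Num.sqrt (expval A u) - Num.sqrt (expval B u)) ^+ 2 / 2
  <= complex.Re (\tr (costQ R 2 *m X)).
Proof.
move=> hu [[pX _] [<- <-]]; have hU := frame_unitary hu.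
rewrite /expval (qform_ptraceB _ _ hU) (qform_ptraceA _ _ hU) !sum2 col0_frame.
set w := col 1 _; rewrite cost_qform.
have -> : eps = u *m w^T - w *m u^T.
  by rewrite -[LHS]scale1r -hu; apply: matrix2P;
    rewrite /w !mxE !big_ord1 ?mxE /=; ring.
have ketB (G H : 'M[C]_2) : ket (G - H) = ket G - ket H.
  by apply/matrixP => i j; rewrite !mxE.
rewrite ketB.
have -> : 2^-1 * qform X (ket (u *m w^T) - ket (w *m u^T)) =
   (2^-1)%:C%C * qform X (ket (u *m w^T) - ket (w *m u^T)).
  by rewrite fmorphV rmorph_nat.
have ReZ (a : R) (z : C) : complex.Re (a%:C%C * z) = a * complex.Re z.
  by case: z => x y /=; rewrite mul0r subr0.
rewrite ReZ mulrC ler_pM2l ?invr_gt0 //.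
apply: le_trans (psd_qformB_ge _ _ pX).
by rewrite !raddfD; apply: sqrtB_shift; apply: Re_ge0; apply: psd_qform_ge0.
Qed.

(** * Compactness of the unit sphere and existence of a maximiser *)

Section Sphere.
Local Open Scope classical_set_scope.

(** Real coordinates on C^2 turn the unit vectors into the sphere of R^4, where compactness and
    continuity are available. *)
Definition spinor (x : 'rV[R]_4) : 'cV[C]_2 :=
  \col_i if i == 0 then Complex (x 0 0) (x 0 1) else Complex (x 0 2) (x 0 3).

Lemma spinor_surj u : exists x, spinor x = u.
Proof.
exists (\row_(k < 4) nth 0 [:: complex.Re (u 0 0); complex.Im (u 0 0);
   complex.Re (u 1 0); complex.Im (u 1 0)] k).
apply/matrixP => i j; rewrite !mxE /= (ord1 j).
by elim/ord2P: i => /=; case: (u _ 0).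
Qed.

Lemma expval_spinor_continuous (A : 'M[C]_2) : continuous (fun x : 'rV[R]_4 => expval A (spinor x)).
Proof.
have -> : (fun x => expval A (spinor x)) = fun x =>
    complex.Re (A 0 0) * (x 0 0 * x 0 0 + x 0 1 * x 0 1) +
    complex.Re (A 1 1) * (x 0 2 * x 0 2 + x 0 3 * x 0 3) +
    complex.Re (A 0 1 + A 1 0) * (x 0 0 * x 0 2 + x 0 1 * x 0 3) +
    complex.Im (A 1 0 - A 0 1) * (x 0 0 * x 0 3 - x 0 1 * x 0 2).
  apply/funext => x; rewrite /expval qform2E !mxE /=.
  move: (x 0 0) (x 0 1) (x 0 2) (x 0 3) => x0 x1 x2 x3.
  by case: (A 0 0) (A 0 1) (A 1 0) (A 1 1) => [a a'] [b b'] [c c'] [d d'] /=; ring.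
have cM (k : R) (f : 'rV[R]_4 -> R) : continuous f -> continuous (fun x => k * f x).
  by move=> cf x; apply: (continuous_comp (cf x)); exact: mulrl_continuous.
have cx i j : continuous (fun x : 'rV[R]_4 => x 0 i * x 0 j).
  by move=> x; apply: continuousM; exact: coord_continuous.
have cD (f g : 'rV[R]_4 -> R) : continuous f -> continuous g ->
    continuous (fun x => f x + g x).
  by move=> cf cg x; exact: continuousD (cf x) (cg x).
have cB (f g : 'rV[R]_4 -> R) : continuous f -> continuous g ->
    continuous (fun x => f x - g x).
  by move=> cf cg x; exact: continuousB (cf x) (cg x).
apply: (cD); last by apply: (cM); apply: cB; exact: cx.
apply: (cD); last by apply: (cM); apply: (cD); exact: cx.
by apply: (cD); apply: (cM); apply: (cD); exact: cx.
Qed.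

Lemma unitvE (u : 'cV[C]_2) : unitv u <-> expval 1%:M u = 1.
Proof.
rewrite /unitv /expval qform2E !mxE /=.
case: (u 0 0) (u 1 0) => [a b] [c d]; simpc; split.
  by case.
by move=> /= ->; congr Complex; ring.
Qed.

(** The extreme value theorem applies, since the sphere is a closed subset of the cube with sides
    [-1, 1]. *)
Lemma unitv_argmax (A B : 'M[C]_2) : exists2 u, unitv u & forall v, unitv v ->
  Num.sqrt (expval A v) - Num.sqrt (expval B v) <= Num.sqrt (expval A u) - Num.sqrt (expval B u).
Proof.
pose S := [set x : 'rV[R]_4 | expval 1%:M (spinor x) = 1].
have cS : compact S.
  have /subclosed_compact : closed S.
    apply: (@closed_comp _ _ (fun x => expval 1%:M (spinor x)) [set 1]); last exact: closed_eq.
    by move=> x _; exact: expval_spinor_continuous.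
  apply; first exact: (@rV_compact R 4 (fun=> `[-1, 1]%classic) (fun=> @segment_compact _ _ _)).
  move=> x; rewrite /S /= => h.
  have {}h : x 0 0 ^+ 2 + x 0 1 ^+ 2 + x 0 2 ^+ 2 + x 0 3 ^+ 2 = 1.
    by rewrite -h /expval qform2E !mxE /=; ring.
  have bnd : forall i, x 0 i ^+ 2 <= 1.
    have := (sqr_ge0 (x 0 0), sqr_ge0 (x 0 1), sqr_ge0 (x 0 2), sqr_ge0 (x 0 3)).
    case=> -[[h0 h1] h2] h3.
    case=> -[|[|[|[|//]]]] i; rewrite -[leRHS]h.
    - by rewrite (_ : Ordinal _ = 0); [lra|exact: val_inj].
    - by rewrite (_ : Ordinal _ = 1); [lra|exact: val_inj].
    - by rewrite (_ : Ordinal _ = 2); [lra|exact: val_inj].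
    - by rewrite (_ : Ordinal _ = 3); [lra|exact: val_inj].
  move=> i; rewrite /= in_itv /= -ler_norml -(@ler_pXn2r _ 2) ?nnegrE //.
  by rewrite real_normK ?num_real // expr1n.
have [||x Sx hx] := @compact_EVT_max _ R (fun x => Num.sqrt (expval A (spinor x)) -
    Num.sqrt (expval B (spinor x))) S _ cS.
- have [x hx] := spinor_surj (\col_i (i == 0)%:R).
  exists x; rewrite /S /= hx; apply/unitvE.
  by rewrite /unitv !mxE !rmorph_nat /= mulr1 mul0r addr0.
- apply: continuous_subspaceT => x.
  have cF M : continuous (fun y : 'rV[R]_4 => Num.sqrt (expval M (spinor y))).
    move=> y; apply: (@continuous_comp _ _ _ (fun z => expval M (spinor z)) Num.sqrt).
      exact: expval_spinor_continuous.
    exact: sqrt_continuous.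
  exact: continuousB (cF A x) (cF B x).
exists (spinor x); first by apply/unitvE; move: Sx; rewrite inE.
move=> v /unitvE; have [y <-] := spinor_surj v => hy.
by apply: hx; rewrite inE.
Qed.

End Sphere.

(** * Expectation values, diagonalisation and stationarity *)

Local Notation infr u A := (hadj (frame u) *m A *m frame u).

Lemma qform_real n (M : 'M[C]_n) v : Defs.hermitian M -> (qform M v)^*%C = qform M v.
Proof.
move=> hM; rewrite -hadjE /qform; congr fun_of_matrix.
by rewrite !hadjM hadjK -hM mulmxA.
Qed.

Lemma expvalE (M : 'M[C]_2) v : Defs.hermitian M -> qform M v = (expval M v)%:C%C.
Proof.
move=> hM; have := qform_real v hM; rewrite /expval; case: (qform M v) => x y /= [/eqP].
by rewrite eqNr => /eqP ->.
Qed.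

Lemma expvalD (A B : 'M[C]_2) v : expval (A + B) v = expval A v + expval B v.
Proof. by rewrite /expval qformD raddfD. Qed.

Lemma expvalZ (a : R) (A : 'M[C]_2) v : expval (a%:C%C *: A) v = a * expval A v.
Proof. by rewrite /expval qformZ; case: (qform A v) => x y /=; rewrite mul0r subr0. Qed.

Lemma hermitianD n (A B : 'M[C]_n) :
  Defs.hermitian A -> Defs.hermitian B -> Defs.hermitian (A + B).
Proof. by rewrite /Defs.hermitian hadjD => <- <-. Qed.

Lemma hermitianZ n (a : R) (A : 'M[C]_n) :
  Defs.hermitian A -> Defs.hermitian (a%:C%C *: A).
Proof. by rewrite /Defs.hermitian hadjZ conjc_real => <-. Qed.

Lemma hermitian1 n : Defs.hermitian (1%:M : 'M[C]_n).
Proof. exact: (psd1 n).1. Qed.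

Lemma expval_ge0 (A : 'M[C]_2) v : psd A -> 0 <= expval A v.
Proof. by move=> pA; apply: Re_ge0; apply: psd_qform_ge0. Qed.

(** A nonzero vector is brought to the sphere by the factor [s], which multiplies the form by the
    positive number [s ^+ 2]. *)
Lemma psd_of_unitv (M : 'M[C]_2) : Defs.hermitian M ->
  (forall u, unitv u -> 0 <= expval M u) -> psd M.
Proof.
move=> hM pos; split=> // v; rewrite -/(qform M v) expvalE // ler0c.
pose N := expval 1%:M v.
have N0 : 0 <= N by apply/expval_ge0/psd1.
have [N00|Npos] := eqVneq N 0.
  have -> : v = 0.
    move: N00; rewrite /N /expval qform2E !mxE /=.
    case E0: (v 0 0) => [a b]; case E1 : (v 1 0) => [c d] /= h.
    have [a0 b0 c0 d0] : [/\ a = 0, b = 0, c = 0 & d = 0].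
      by split; have := (sqr_ge0 a, sqr_ge0 b, sqr_ge0 c, sqr_ge0 d);
        case=> -[[h0 h1] h2] h3; apply/eqP; rewrite -sqrf_eq0 -[_ == 0]orbF; apply/orP; left;
        rewrite eq_le sqr_ge0 andbT; lra.
    apply/matrixP => i j; rewrite (ord1 j) mxE.
    by elim/ord2P: i; rewrite ?E0 ?E1 ?a0 ?b0 ?c0 ?d0.
  by rewrite /expval /qform mulmx0 mxE.
pose s := (Num.sqrt N)^-1.
have sN : s ^+ 2 * N = 1 by rewrite exprVn sqr_sqrtr // mulVf.
have scale H : expval H (s%:C%C *: v) = s ^+ 2 * expval H v.
  rewrite /expval qform_scale conjc_real -rmorphM -expr2.
  by case: (qform H v) => x y /=; rewrite mul0r subr0.
have : 0 <= expval M (s%:C%C *: v) by apply: pos; apply/unitvE; rewrite scale.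
by rewrite scale pmulr_rge0 // exprn_gt0 // invr_gt0 sqrtr_gt0 lt_def Npos.
Qed.

Lemma expval_frame (M : 'M[C]_2) u :
  expval M u = complex.Re ((hadj (frame u) *m M *m frame u) 0 0).
Proof. by rewrite congr_entry col0_frame. Qed.

(** The (0, 0) entry in the frame is the expectation at [u], so the minor inequality forces the
    off-diagonal entry to vanish. This extracts first-order conditions at an extremal vector without
    derivatives. *)
Lemma psd_kernel (M : 'M[C]_2) u : psd M -> expval M u = 0 ->
  (hadj (frame u) *m M *m frame u) 0 1 = 0.
Proof.
move=> pM M0; have pF := psd_congr (frame u) pM.
have := psd2_minor pF.
rewrite (ReK (psd_diag_ge0 0 pF)) -expval_frame M0 mul0r => h.
have := mulcJ_ge0 ((hadj (frame u) *m M *m frame u) 0 1) => h'.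
have /eqP : (hadj (frame u) *m M *m frame u) 0 1 *
  ((hadj (frame u) *m M *m frame u) 0 1)^*%C == 0 by rewrite eq_le h h'.
by move/eqP; rewrite mulf_eq0 conjc_eq0 orbb => /eqP.
Qed.

(** A minimiser of the form is an eigenvector: [M], which is [H] minus its minimum, is positive and
    vanishes at [u], so [psd_kernel] applies. *)
Lemma psd_diagonalize (H : 'M[C]_2) : psd H -> exists2 u, unitv u &
  (hadj (frame u) *m H *m frame u) 0 1 = 0 /\
  complex.Re ((hadj (frame u) *m H *m frame u) 0 0) <=
  complex.Re ((hadj (frame u) *m H *m frame u) 1 1).
Proof.
(* With 0 as first matrix, the maximised function is -sqrt <v,Hv>. *)
move=> pH; have [u hu umax] := unitv_argmax 0 H.
have umin v : unitv v -> expval H u <= expval H v.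
  move=> /umax.
  have z w : expval (0 : 'M[C]_2) w = 0 by rewrite /expval /qform mulmx0 mul0mx mxE.
  by rewrite !z lerD2l lerN2 ler_sqrt // expval_ge0.
exists u => //.
pose M := H + (- expval H u)%:C%C *: 1%:M.
have pM : psd M.
  apply: psd_of_unitv => [|v hv].
    by apply: hermitianD; [exact: pH.1|exact/hermitianZ/hermitian1].
  by rewrite expvalD expvalZ (unitvE v).1 // mulr1 subr_ge0 umin.
have M0 : expval M u = 0 by rewrite expvalD expvalZ (unitvE u).1 // mulr1 subrr.
have ME : hadj (frame u) *m M *m frame u =
    hadj (frame u) *m H *m frame u + (- expval H u)%:C%C *: 1%:M.
  by rewrite mulmxDr mulmxDl -scalemxAr -scalemxAl mulmx1 frame_unitary.
have pF := psd_congr (frame u) pM.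
split; first by have := psd_kernel pM M0; rewrite ME !mxE mulr0 addr0.
rewrite -expval_frame -subr_ge0.
have := Re_ge0 (psd_diag_ge0 1 pF); rewrite ME.
by rewrite [X in complex.Re X]mxE [X in _ + X]mxE [X in _ * X]mxE mulr1 raddfD.
Qed.

Lemma psd_trace0 (M : 'M[C]_2) : psd M -> \tr M = 0 -> M = 0.
Proof.
move=> pM; rewrite /mxtrace sum2 => /eqP.
rewrite paddr_eq0 ?psd_diag_ge0 // => /andP[/eqP M00 /eqP M11].
have M01 : M 0 1 = 0.
  have := psd2_minor pM; rewrite M00 mul0r => h; apply/eqP.
  by have := mulcJ_ge0 (M 0 1) => h'; have : M 0 1 * (M 0 1)^*%C == 0;
    [rewrite eq_le h h'|rewrite mulf_eq0 conjc_eq0 orbb].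
by apply: matrix2P; rewrite ?mxE // -(psd_conj 0 1 pM) M01 conjc0.
Qed.

Lemma trace_frame (M : 'M[C]_2) u : unitv u ->
  \tr (hadj (frame u) *m M *m frame u) = \tr M.
Proof. by move=> hu; rewrite mxtrace_mulC mulmxA (mulmx1C (frame_unitary hu)) mul1mx. Qed.

(* Where [sqrt A - sqrt B] is maximal, AM-GM turns the inequality
   [sqrt A <= sqrt B + m] into positivity of an affine combination [M] of [A], [B]
   and the identity, which vanishes at the maximiser. *)
Lemma stationary_frame (A B : 'M[C]_2) : density A -> density B -> A <> B ->
  exists2 u, unitv u & expval B u < expval A u /\
    (Num.sqrt (expval B u))%:C%C * (hadj (frame u) *m A *m frame u) 0 1 =
    (Num.sqrt (expval A u))%:C%C * (hadj (frame u) *m B *m frame u) 0 1.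
Proof.
move=> [pA tA] [pB tB] AB; have [u hu umax] := unitv_argmax A B.
have hA := pA.1; have hB := pB.1.
exists u; first exact: hu.
(* Were the maximum not positive, B - A would be a positive matrix of trace zero, hence zero. *)
have BA : expval B u < expval A u.
  rewrite ltNge; apply/negP => leAB; apply: AB; apply/eqP; rewrite eq_sym -subr_eq0.
  have -> : B - A = B + (-1)%:C%C *: A by rewrite rmorphN1 scaleN1r.
  apply/eqP/psd_trace0; last by rewrite rmorphN1 scaleN1r raddfB /= tA tB subrr.
  apply: psd_of_unitv => [|v hv]; first exact/hermitianD/hermitianZ.
  rewrite expvalD expvalZ mulN1r subr_ge0 -ler_sqrt ?expval_ge0 // -subr_le0.
  by rewrite (le_trans (umax v hv)) // subr_le0 ler_sqrt ?expval_ge0.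
split; first exact: BA.
set s := Num.sqrt (expval B u) in umax *; set S := Num.sqrt (expval A u) in umax *.
have s0 : 0 <= s by apply: sqrtr_ge0.
have sS : s < S by rewrite ltr_sqrt // (le_lt_trans _ BA) // expval_ge0.
have [b0|bN0] := eqVneq (expval B u) 0.
  by rewrite (psd_kernel pB b0) /s b0 sqrtr0 mul0r mulr0.
have spos : 0 < s by rewrite sqrtr_gt0 lt_def bN0 expval_ge0.
have s2 : s ^+ 2 = expval B u by rewrite sqr_sqrtr // expval_ge0.
have S2 : S ^+ 2 = expval A u by rewrite sqr_sqrtr // expval_ge0.
(* With m = S - s, the coefficients come from (q + m)^2 <= (S / s) q^2 + m S, an equality at q =
   s. *)
pose M := (S / s)%:C%C *: B + ((S - s) * S)%:C%C *: 1%:M + (-1)%:C%C *: A.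
have expM v : unitv v -> expval M v = S / s * expval B v + (S - s) * S - expval A v.
  by move=> hv; rewrite !expvalD !expvalZ (unitvE v).1 // mulr1 mulN1r.
have pM : psd M.
  apply: psd_of_unitv => [|v hv].
    by apply: hermitianD; [apply: hermitianD|]; apply: hermitianZ => //; exact: hermitian1.
  rewrite expM //; have := umax v hv; have := sqrtr_ge0 (expval A v).
  have := sqr_sqrtr (expval_ge0 v pA); have := sqr_sqrtr (expval_ge0 v pB).
  move: (Num.sqrt (expval A v)) (Num.sqrt (expval B v)) => p q <- <- p0 pq.
  have h1 : p ^+ 2 <= (q + (S - s)) ^+ 2.
    by rewrite ler_pXn2r ?nnegrE //; lra.
  rewrite subr_ge0; apply: le_trans h1 _; rewrite -subr_ge0.
  have -> : S / s * q ^+ 2 + (S - s) * S - (q + (S - s)) ^+ 2 = (S - s) / s * (q - s) ^+ 2.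
    by field; rewrite gt_eqF.
  apply: mulr_ge0; last exact: sqr_ge0.
  by apply: divr_ge0; [rewrite subr_ge0 ltW|exact: s0].
have M0 : expval M u = 0.
  by rewrite expM // -s2 -S2; field; rewrite gt_eqF.
have := psd_kernel pM M0.
have -> : hadj (frame u) *m M *m frame u = (S / s)%:C%C *: (hadj (frame u) *m B *m frame u)
   + ((S - s) * S)%:C%C *: 1%:M + (-1)%:C%C *: (hadj (frame u) *m A *m frame u).
  rewrite !mulmxDr !mulmxDl -!scalemxAr -!scalemxAl mulmx1 frame_unitary //.
move: (hadj _ *m A *m _) (hadj _ *m B *m _) => A' B'.
rewrite !mxE mulr0 addr0 rmorphN1 mulN1r => /eqP; rewrite subr_eq0 => /eqP <-.
rewrite mulrA -rmorphM mulrCA divff ?mulr1; first reflexivity.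
by rewrite gt_eqF.
Qed.

(** * Trace and determinant of a density matrix in a frame *)

Definition sqmod (z : C) : R := complex.Re z ^+ 2 + complex.Im z ^+ 2.

Lemma sqmodE z : z * z^*%C = (sqmod z)%:C%C.
Proof. by case: z => x y; rewrite /sqmod /=; simpc; congr Complex; ring. Qed.

Lemma sqmodZ (a : R) z : sqmod (a%:C%C * z) = a ^+ 2 * sqmod z.
Proof. by case: z => x y; rewrite /sqmod /=; ring. Qed.

Lemma density_frame (A : 'M[C]_2) u : unitv u -> density A -> density (infr u A).
Proof. by move=> hu [pA tA]; split; [exact: psd_congr|rewrite trace_frame]. Qed.

Lemma density2E (A : 'M[C]_2) (a := complex.Re (A 0 0)) : density A ->
  [/\ 0 <= a, A 0 0 = a%:C%C, A 1 0 = (A 0 1)^*%C & A 1 1 = (1 - a)%:C%C].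
Proof.
move=> [pA tA]; have A00 : A 0 0 = a%:C%C by exact/ReK/psd_diag_ge0.
split=> //; first by apply: Re_ge0; exact: psd_diag_ge0.
  by rewrite psd_conj.
by move: tA; rewrite /mxtrace sum2 A00 rmorphB rmorph1 => <-; rewrite addrAC subrr add0r.
Qed.

Lemma det_frame (A : 'M[C]_2) u : unitv u -> \det (infr u A) = \det A.
Proof.
move=> hu; rewrite !det_mulmx mulrC mulrA -det_mulmx (mulmx1C (frame_unitary hu)).
by rewrite det1 mul1r.
Qed.

Lemma det_density (A : 'M[C]_2) (a := complex.Re (A 0 0)) : density A ->
  complex.Re (\det A) = a * (1 - a) - sqmod (A 0 1).
Proof.
move=> dA; have [_ A00 A10 A11] := density2E dA.
rewrite (expand_det_row _ 0) sum2 /cofactor !det_mx11 !mxE /=.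
have -> : lift 0 0 = 1 :> 'I_2 by exact: val_inj.
have -> : lift 1 0 = 0 :> 'I_2 by exact: val_inj.
rewrite A10 A00 A11 -/a /sqmod; case: (A 0 1) => x y /=.
by ring.
Qed.

(* With [A01 = sqrt a t] and [B01 = sqrt b t] one has
   [det A - det B = (a - b) (1 - a - b - |t|^2)]. *)
Lemma adapted_frame (A B : 'M[C]_2) : density A -> density B ->
  complex.Re (\det B) <= complex.Re (\det A) ->
  exists u t, [/\ unitv u, infr u A 0 1 = (Num.sqrt (expval A u))%:C%C * t,
    infr u B 0 1 = (Num.sqrt (expval B u))%:C%C * t &
    0 <= 1 - expval A u - expval B u - sqmod t].
Proof.
move=> dA dB hdet.
have sq0 : sqmod 0 = 0 by rewrite /sqmod /= expr0n /= addr0.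
(* For equal states stationarity says nothing; an eigenbasis is used with t = 0, and the smaller
   eigenvalue is at most 1/2. *)
have [AB|AB] := eqVneq A B.
  have [u hu [A01 le]] := psd_diagonalize dA.1; exists u, 0; rewrite -AB !mulr0.
  split=> //; have [_ _ _ A11] := density2E (density_frame hu dA).
  by move: le; rewrite A11 sq0 /= -expval_frame; lra.
have [u hu [ba h]] := stationary_frame dA dB (elimN eqP AB).
have a0 : 0 < expval A u by apply: le_lt_trans ba; exact: expval_ge0 dB.1.
have b0 : 0 <= expval B u by exact: expval_ge0 dB.1.
have sa : (Num.sqrt (expval A u))%:C%C != 0 :> C.
  by rewrite fmorph_eq0; apply/lt0r_neq0; rewrite sqrtr_gt0.
set t := infr u A 0 1 / (Num.sqrt (expval A u))%:C%C.
have tA : infr u A 0 1 = (Num.sqrt (expval A u))%:C%C * t by rewrite mulrC (divfK sa).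
have tB : infr u B 0 1 = (Num.sqrt (expval B u))%:C%C * t.
  by rewrite mulrA h mulrAC (divff sa) mul1r.
exists u, t; split; [exact: hu|exact: tA|exact: tB|].
have nA : sqmod (infr u A 0 1) = expval A u * sqmod t.
  by rewrite [in LHS]tA sqmodZ (sqr_sqrtr (ltW a0)).
have nB : sqmod (infr u B 0 1) = expval B u * sqmod t.
  by rewrite [in LHS]tB sqmodZ (sqr_sqrtr b0).
have dA' := det_density (density_frame hu dA).
have dB' := det_density (density_frame hu dB).
move: hdet; rewrite -(det_frame A hu) -(det_frame B hu) dA' dB'.
rewrite -!expval_frame.
rewrite nA nB.
move: (expval A u) (expval B u) (sqmod t) ba => a b n ba.
rewrite -subr_ge0.
have -> : a * (1 - a) - a * n - (b * (1 - b) - b * n) = (a - b) * (1 - a - b - n) by ring.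
by rewrite pmulr_rge0; [exact|rewrite subr_gt0].
Qed.

(** * Construction of the optimal coupling *)

Definition mx2 (x y z w : C) : 'M[C]_2 :=
  \matrix_(i, j) if i == 0 then (if j == 0 then x else y) else if j == 0 then z else w.

Lemma mx2E (A : 'M[C]_2) : A = mx2 (A 0 0) (A 0 1) (A 1 0) (A 1 1).
Proof. by apply: matrix2P; rewrite mxE. Qed.

Lemma mx2_add x y z w x' y' z' w' :
  mx2 x y z w + mx2 x' y' z' w' = mx2 (x + x') (y + y') (z + z') (w + w').
Proof. by apply: matrix2P; rewrite !mxE. Qed.

Lemma mx2_mul x y z w x' y' z' w' : mx2 x y z w *m mx2 x' y' z' w' =
  mx2 (x * x' + y * z') (x * y' + y * w') (z * x' + w * z') (z * y' + w * w').
Proof. by apply: matrix2P; rewrite !mxE sum2 !mxE. Qed.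

Lemma mx2_tr x y z w : (mx2 x y z w)^T = mx2 x z y w.
Proof. by apply: matrix2P; rewrite !mxE. Qed.

Lemma mx2_hadj x y z w : hadj (mx2 x y z w) = mx2 x^*%C z^*%C y^*%C w^*%C.
Proof. by apply: matrix2P; rewrite !mxE. Qed.

(** [ket G] has no |00> amplitude, so the term shared by both marginals in the lower bound vanishes.
    Its amplitudes on |01>, |10> and |11> produce the first rows of [A] and [B], and [ket H], a
    symmetric multiple of |11>, supplies the missing diagonal weight 1 - a - b - |t|^2. *)
Lemma canonical_factor (A B : 'M[C]_2) (t : C) (a b : R) :
  density A -> density B -> 0 <= a -> 0 <= b -> a = complex.Re (A 0 0) -> b = complex.Re (B 0 0) ->
  0 <= 1 - a - b - sqmod t ->
  A 0 1 = (Num.sqrt a)%:C%C * t -> B 0 1 = (Num.sqrt b)%:C%C * t ->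
  exists G H : 'M[C]_2,
  [/\ G *m hadj G + H *m hadj H = A, G^T *m hadj G^T + H^T *m hadj H^T = B,
      G 0 1 - G 1 0 = (Num.sqrt a - Num.sqrt b)%:C%C & H 0 1 = H 1 0].
Proof.
move=> dA dB a0 b0 aE bE m0 A01 B01.
have [_ A00 A10 A11] := density2E dA; have [_ B00 B10 B11] := density2E dB.
pose h' : C := (Num.sqrt (1 - a - b - sqmod t))%:C%C.
exists (mx2 0 (Num.sqrt a)%:C%C (Num.sqrt b)%:C%C t^*%C), (mx2 0 0 0 h').
have sq (x : R) : 0 <= x -> (Num.sqrt x)%:C%C * (Num.sqrt x)%:C%C = x%:C%C :> C.
  by move=> x0; rewrite -rmorphM -expr2 sqr_sqrtr.
have hh : h' * h' = 1 - a%:C%C - b%:C%C - t * t^*%C.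
  by rewrite (sq _ m0) sqmodE !rmorphB rmorph1.
move: (sq _ a0) (sq _ b0) => sa sb.
rewrite (mx2E A) (mx2E B) !mx2_tr !mx2_hadj !mx2_mul !mx2_add.
have cM (x : R) z : (x%:C%C * z)^*%C = x%:C%C * z^*%C :> C.
  by rewrite rmorphM; congr (_ * _); exact: conjc_real.
have rB (x : R) : (1 - x)%:C%C = 1 - x%:C%C :> C by rewrite rmorphB rmorph1.
rewrite A00 B00 A10 B10 A11 B11 -aE -bE A01 B01 !cM !rB conjc0 !conjc_real conjcK hh sa sb.
split.
- by congr mx2; ring.
- by congr mx2; ring.
- by rewrite !mxE rmorphB.
- by rewrite !mxE.
Qed.

Lemma frame_conj_infr (A : 'M[C]_2) u : unitv u ->
  frame u *m infr u A *m hadj (frame u) = A.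
Proof.
move=> hu; have UU := mulmx1C (frame_unitary hu).
by rewrite !mulmxA UU mul1mx -mulmxA UU mulmx1.
Qed.

(** Sending [G] to U G U^T is the action of U (x) U on [ket G], so the marginals are conjugated by
    U. *)
Lemma frame_gram (G : 'M[C]_2) u : unitv u ->
  (frame u *m G *m (frame u)^T) *m hadj (frame u *m G *m (frame u)^T) =
  frame u *m (G *m hadj G) *m hadj (frame u).
Proof.
move=> hu; have UU : (frame u)^T *m hadj (frame u)^T = 1%:M.
  rewrite -[RHS]trmx1 -(frame_unitary hu) trmx_mul; congr (_ *m _).
  by apply/matrixP => i j; rewrite !mxE.
by rewrite !hadjM -!mulmxA (mulmxA (frame u)^T) UU mul1mx.
Qed.

(** The antisymmetric part is multiplied by the determinant of the frame, which is 1. *)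
Lemma frame_antisym (G : 'M[C]_2) u : unitv u ->
  (frame u *m G *m (frame u)^T) 0 1 - (frame u *m G *m (frame u)^T) 1 0 =
  G 0 1 - G 1 0.
Proof.
move=> hu; rewrite -[RHS]mul1r -hu.
by rewrite !mxE !sum2 !mxE !sum2 !mxE /=; ring.
Qed.

(** Coefficient matrices of a coupling with at most two pure components, the second symmetric and
    thus free of cost. *)
Definition factors (A B G H : 'M[C]_2) : Prop :=
  [/\ G *m hadj G + H *m hadj H = A, G^T *m hadj G^T + H^T *m hadj H^T = B
    & H 0 1 = H 1 0].

Lemma factors_sym A B G H : factors A B G H -> factors B A G^T H^T.
Proof. by case=> hA hB hH; split; rewrite ?trmxK // !mxE. Qed.

Lemma optimal_factors_det (A B : 'M[C]_2) : density A -> density B ->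
  complex.Re (\det B) <= complex.Re (\det A) ->
  exists u G H, [/\ unitv u, factors A B G H &
    G 0 1 - G 1 0 = (Num.sqrt (expval A u) - Num.sqrt (expval B u))%:C%C].
Proof.
move=> dA dB hdet; have [u [t [hu hA hB hm]]] := adapted_frame dA dB hdet.
have [G [H [GA GB GG HH]]] := canonical_factor (density_frame hu dA)
  (density_frame hu dB) (expval_ge0 u dA.1) (expval_ge0 u dB.1)
  (expval_frame A u) (expval_frame B u) hm hA hB.
exists u, (frame u *m G *m (frame u)^T), (frame u *m H *m (frame u)^T).
split; [exact: hu| |by rewrite frame_antisym].
have tr M : (frame u *m M *m (frame u)^T)^T = frame u *m M^T *m (frame u)^T.
  by rewrite !trmx_mul trmxK mulmxA.
split.
- by rewrite !frame_gram // -mulmxDl -mulmxDr GA frame_conj_infr.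
- by rewrite !tr !frame_gram // -mulmxDl -mulmxDr GB frame_conj_infr.
- by apply/eqP; rewrite -subr_eq0 frame_antisym // HH subrr.
Qed.

(** Transposing the coefficient matrices exchanges the marginals, so the two states may be ordered
    by determinant. *)
Lemma optimal_factors (A B : 'M[C]_2) : density A -> density B ->
  exists u G H, [/\ unitv u, factors A B G H &
    (G 0 1 - G 1 0) * (G 0 1 - G 1 0)^*%C =
    ((Num.sqrt (expval A u) - Num.sqrt (expval B u)) ^+ 2)%:C%C].
Proof.
have sqR (x : R) : x%:C%C * (x%:C%C)^*%C = (x ^+ 2)%:C%C.
  by rewrite sqmodE /sqmod /= expr0n addr0.
move=> dA dB; have [hdet|/ltW hdet] := leP (complex.Re (\det B)) (complex.Re (\det A)).
  have [u [G [H [hu hf GG]]]] := optimal_factors_det dA dB hdet.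
  exists u, G, H; split; [exact: hu|exact: hf|].
  by rewrite GG sqR.
have [u [G [H [hu hf GG]]]] := optimal_factors_det dB dA hdet.
exists u, G^T, H^T; split; [exact: hu|exact: factors_sym|].
have -> : G^T 0 1 - G^T 1 0 = (Num.sqrt (expval A u) - Num.sqrt (expval B u))%:C%C.
  by rewrite !mxE -opprB GG -rmorphN opprB.
exact: sqR.
Qed.

Lemma optimal_coupling (A B : 'M[C]_2) : density A -> density B ->
  exists2 u, unitv u & exists2 X, couplings A B X &
    complex.Re (\tr (costQ R 2 *m X)) =
    (Num.sqrt (expval A u) - Num.sqrt (expval B u)) ^+ 2 / 2.
Proof.
move=> dA dB; have [u [G [H [hu [hA hB hH] hG]]]] := optimal_factors dA dB.
exists u; first exact: hu.
exists (ket G *m hadj (ket G) + ket H *m hadj (ket H)).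
  have hpB : ptraceB (ket G *m hadj (ket G) + ket H *m hadj (ket H)) = A.
    by rewrite ptraceBD !ptraceB_gram.
  split; last by split; [exact: hpB|rewrite ptraceAD !ptraceA_gram].
  split; first by apply: psdD; exact: psd_gram.
  by rewrite -mxtrace_ptraceB hpB; exact: dA.2.
rewrite mulmxDr raddfD /= !cost_gram hH subrr mul0r mulr0 addr0 hG.
have -> : 2^-1 = (2^-1)%:C%C :> C by rewrite fmorphV rmorph_nat.
by rewrite -rmorphM /= mulrC.
Qed.

(** * Completely positive maps and their effects *)

(** This is complete positivity at k = 1; [V] and [W] relabel between C^1 (x) C^n and C^n. *)
Lemma completely_positive_psd n (Phi : 'M[C]_n -> 'M[C]_n) M :
  completely_positive Phi -> psd M -> psd (Phi M).
Proof.
move=> cp pM; pose V : 'M[C]_(n, 1 * n) := \matrix_(x, a) ((mxtens_unindex a).2 == x)%:R.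
pose W : 'M[C]_(1 * n, n) := \matrix_(a, x) ((mxtens_unindex a).2 == x)%:R.
have VE p q : (hadj V *m M *m V) (mxtens_index (p, q.1)) (mxtens_index (p, q.2)) = M q.1 q.2.
  rewrite congr_entry; set v := col _ _; set w := col _ _.
  have -> : v = delta_mx q.1 0.
    by apply/matrixP => i j; rewrite !mxE mxtens_indexK (ord1 j) eqxx andbT eq_sym.
  have -> : w = delta_mx q.2 0.
    by apply/matrixP => i j; rewrite !mxE mxtens_indexK (ord1 j) eqxx andbT eq_sym.
  have -> : hadj (delta_mx q.1 0) = delta_mx 0 q.1 :> 'rV[C]_n.
    by apply/matrixP => i j; rewrite !mxE rmorph_nat andbC.
  by rewrite -rowE -colE !mxE.
have pA := psd_congr W (cp 1%N _ (psd_congr V pM)).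
suff <- : hadj W *m ampliate Phi (hadj V *m M *m V) *m W = Phi M by [].
apply/matrixP => i j; rewrite congr_entry.
have colW k : col k W = delta_mx (mxtens_index (0, k)) 0.
  apply/matrixP => a l; rewrite !mxE (ord1 l) eqxx andbT.
  case: (mxtens_indexP a) => p q; rewrite mxtens_indexK /= (ord1 p).
  by rewrite (can_eq (@mxtens_indexK _ _)) xpair_eqE eqxx.
rewrite !colW.
have -> : hadj (delta_mx (mxtens_index (0, i)) 0) = delta_mx 0 (mxtens_index (0, i)) :> 'rV[C]_(1 * n).
  by apply/matrixP => k l; rewrite !mxE rmorph_nat andbC.
rewrite -rowE -colE !mxE !mxtens_indexK /=; congr (Phi _ i j).
by apply/matrixP => x y; rewrite mxE (VE 0 (x, y)).
Qed.

(** Nonnegative complex numbers are real, and reality of the form at (1, 0), (0, 1), (1, 1) and (1,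
    i) forces [M] to be Hermitian. *)
Lemma psd_of_qform (M : 'M[C]_2) : (forall v, 0 <= qform M v) -> psd M.
Proof.
move=> pos; split; last exact: pos.
have q (x y : C) := pos (\col_i if i == 0 then x else y).
move: (q 1 0) (q 0 1) (q 1 1) (q 1 'i%C); clear.
rewrite !qform2E !mxE /= => h1 h2 h3 h4.
move: (ger0_Im h1) (ger0_Im h2) (ger0_Im h3) (ger0_Im h4); clear.
move=> h1 h2 h3 h4; apply: matrix2P; rewrite hadjE; move: h1 h2 h3 h4;
  case: (M 0 0) (M 0 1) (M 1 0) (M 1 1) => [a a'] [b b'] [c c'] [d d'] /= h1 h2 h3 h4;
  congr Complex; lra.
Qed.

(** [E] is the image of [u *m hadj u] under the dual map of [Phi]. It is positive because <v,Ev> is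
    the expectation at [u] of [Phi] applied to the positive matrix [v *m hadj v]. *)
Lemma effect (Phi : {linear 'M[C]_2 -> 'M[C]_2}) u : completely_positive Phi ->
  exists2 E, psd E & forall r, qform (Phi r) u = \tr (E *m r).
Proof.
move=> cp; pose E : 'M[C]_2 := \matrix_(j, i) qform (Phi (delta_mx i j)) u.
have EE r : qform (Phi r) u = \tr (E *m r).
  rewrite [in LHS](matrix_sum_delta r) /mxtrace !sum2 !mxE !sum2 !mxE !linearD !linearZ /=.
  rewrite 3!qformD 4!qformZ.
  move: (qform (Phi (delta_mx 0 0)) u) (qform (Phi (delta_mx 0 1)) u)
    (qform (Phi (delta_mx 1 0)) u) (qform (Phi (delta_mx 1 1)) u) => e0 e1 e2 e3.
  ring.
exists E; last exact: EE.
apply: psd_of_qform => v.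
have -> : qform E v = \tr (E *m (v *m hadj v)).
  by rewrite mulmxA mxtrace_mulC mulmxA trace_mx11.
by rewrite -EE; apply/psd_qform_ge0/completely_positive_psd/psd_gram.
Qed.

Lemma unitv_col1 (u : 'cV[C]_2) : unitv u -> unitv (col 1 (frame u)).
Proof. by rewrite /unitv => <-; rewrite !mxE /= rmorphN /= !conjcK; ring. Qed.

(** In an eigenbasis of the effect, with eigenvalues x <= y, the trace against [r] is x r00 + y r11
    = x + (y - x) r11, as [r] has trace 1; [w] is the eigenvector for [y]. *)
Lemma expval_pullback (Phi : {linear 'M[C]_2 -> 'M[C]_2}) u :
  completely_positive Phi -> trace_preserving Phi -> unitv u ->
  exists2 w, unitv w & exists x d : R, [/\ 0 <= x, 0 <= d <= 1 &
    forall r, density r -> expval (Phi r) u = x + d * expval r w].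
Proof.
move=> cp tp hu; have [E pE hE] := effect u cp.
have [p hp [E01 le01]] := psd_diagonalize pE.
have pF := psd_congr (frame p) pE.
have E10 : infr p E 1 0 = 0 by rewrite -(psd_conj 0 1 pF) E01 conjc0.
set x := complex.Re (infr p E 0 0) in le01; set y := complex.Re (infr p E 1 1) in le01.
have x0 : 0 <= x by apply: Re_ge0; exact: psd_diag_ge0.
have E00 : infr p E 0 0 = x%:C%C by exact/ReK/psd_diag_ge0.
have E11 : infr p E 1 1 = y%:C%C by exact/ReK/psd_diag_ge0.
pose w := col 1 (frame p).
have main r : density r -> expval (Phi r) u = x + (y - x) * expval r w.
  move=> dr; rewrite /expval hE -(trace_frame _ hp).
  have -> : infr p (E *m r) = infr p E *m infr p r.
    by rewrite !mulmxA -(mulmxA _ (frame p) (hadj (frame p))) (mulmx1C (frame_unitary hp)) mulmx1.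
  have dr' := density_frame hp dr; have [_ r00 _ r11] := density2E dr'.
  rewrite /mxtrace sum2 !mxE !sum2 E01 E10 !mul0r add0r addr0 E00 E11.
  have -> : complex.Re (qform r w) = complex.Re (infr p r 1 1) by rewrite congr_entry.
  by rewrite r00 r11 -!rmorphM -rmorphD /=; ring.
have hw : unitv w by exact: unitv_col1.
exists w; first exact: hw.
exists x, (y - x); split; [exact: x0| |exact: main].
rewrite subr_ge0 le01 /=.
(* The bound y <= 1 comes from the pure state of [w]: there [y] is an expectation of the density
   matrix [Phi (w *m hadj w)]. *)
have dw : density (w *m hadj w).
  split; first exact: psd_gram.
  rewrite mxtrace_mulC trace_mx11 mxE sum2 !hadjE -[RHS]hw; ring.
have ew : expval (w *m hadj w) w = 1.
  have -> : expval (w *m hadj w) w = complex.Re ((hadj w *m w *m (hadj w *m w)) 0 0).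
    by rewrite /expval /qform !mulmxA.
  have -> : hadj w *m w = 1%:M.
    by apply/matrixP => i j; rewrite !ord1 !mxE sum2 !hadjE -[RHS]hw; ring.
  by rewrite mulmx1 mxE.
have dPw : density (Phi (w *m hadj w)).
  by split; [exact/completely_positive_psd/dw.1|rewrite tp; exact: dw.2].
have := main _ dw; rewrite ew mulr1 => yE.
have [_ _ _ P11] := density2E (density_frame hu dPw).
have := Re_ge0 (psd_diag_ge0 1 (density_frame hu dPw).1).
rewrite P11 -expval_frame yE /= => h.
by move: h x0; clear; lra.
Qed.

End QubitTransport.

Theorem theorem5p1 (R : realType)
    (Phi : {linear 'M[R[i]]_2 -> 'M[R[i]]_2})
    (Phi_CP : completely_positive Phi) (Phi_TP : trace_preserving Phi)
    (rA rB : 'M[R[i]]_2) (hA : density rA) (hB : density rB) :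
  TQ (Phi rA) (Phi rB) <= TQ rA rB.
Proof.
have dA : density (Phi rA).
  by split; [exact: completely_positive_psd Phi_CP hA.1|rewrite Phi_TP; exact: hA.2].
have dB : density (Phi rB).
  by split; [exact: completely_positive_psd Phi_CP hB.1|rewrite Phi_TP; exact: hB.2].
(* The coupling [Y] makes the set of costs nonempty, so that its infimum is not a default value. *)
have [v hv [Y cY _]] := optimal_coupling hA hB.
apply: lb_le_inf; first by exists (complex.Re (\tr (costQ R 2 *m Y))), Y.
move=> _ [X cX <-].
have [u hu [Z cZ costZ]] := optimal_coupling dA dB.
have lbT : has_lbound [set complex.Re (\tr (costQ R 2 *m rAB)) | rAB in couplings (Phi rA) (Phi rB)].
  exists 0 => _ [W cW <-]; apply: le_trans (cost_ge hu cW).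
  by apply: divr_ge0; [exact: sqr_ge0|exact: ler0n].
apply: le_trans (ge_inf lbT (ex_intro2 _ _ Z cZ erefl)) _.
rewrite costZ.
(* The vector [u] giving the cost of [Z] is pulled back to [w], where the lower bound for the
   arbitrary coupling [X] is applied. *)
have [w hw [x [d [x0 /andP[d0 d1] hPhi]]]] := expval_pullback Phi_CP Phi_TP hu.
apply: le_trans (cost_ge hw cX); rewrite !hPhi; [|exact: hB|exact: hA].
have a0 := expval_ge0 w hA.1; have b0 := expval_ge0 w hB.1.
move: (expval rA w) (expval rB w) a0 b0 => a b a0 b0.
rewrite ler_pM2r ?invr_gt0 ?ltr0n //.
(* The constant [x] is removed by the shift inequality, and then [d <= 1] factors out of the
   square. *)
apply: le_trans (sqrtB_shift x0 (mulr_ge0 d0 a0) (mulr_ge0 d0 b0)) _.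
rewrite !(sqrtrM _ d0) -mulrBr exprMn (sqr_sqrtr d0).
by apply: ler_piMl; [exact: sqr_ge0|exact: d1].
Qed.
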